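(* Let $\mathcal{G}=(B\cup W,E)$ be a finite bipartite planar graph having a dimer cover, let $\nu:E\to\mathbb{R}_{>0}$ be a positive edge weight function, and for each $i\in[k]$ and $e\in E$ let $\nu_i(e)\ge 0$ be such that $\nu(e)=\sum_{i=1}^k\nu_i(e)$. Choose a random dimer cover of $\mathcal{G}$ with probability proportional to the product of the weights $\nu$ of its edges, and, given the dimer cover, color each edge $e$ in it with color $i\in[k]$ with probability $p_i(e)=\nu_i(e)/\nu(e)$, independently for all edges. Let $\mu$ be the induced probability measure on $[k]^W$ which records, for each $w\in W$, the color of the dimer covering $w$. Then $\mu$ is $k$-determinantal.
   Context: $[k]=\{1,\dots,k\}$. A dimer cover is a perfect matching, and its edges are called dimers. For a finite set $W$ with $n$ elements (identified with $[n]$ by any ordering), a probability measure on $[k]^W$ is $k$-determinantal if there are real $n\times n$ matrices $A_1,\dots,A_k$ with $A_1+\dots+A_k=I$ such that for all $(i_1,\dots,i_n)\in[k]^n$, $\Pr((i_1,\dots,i_n))=\det(A_{i_1}^1,A_{i_2}^2,\dots,A_{i_n}^n)$, the determinant of the matrix whose $j$th column is the $j$th column of $A_{i_j}$. *)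

(* Defs.v *)
From HB Require Import structures.
From mathcomp Require Import all_boot all_order all_algebra.
From mathcomp Require Import all_classical all_reals all_analysis.
Set Implicit Arguments.
Unset Strict Implicit.
Unset Printing Implicit Defensive.
Import Order.TTheory GRing.Theory Num.Theory.
Import numFieldNormedType.Exports.
Local Open Scope classical_set_scope.
Local Open Scope ring_scope.

(* The edges form a type of their own, so parallel edges are allowed; simple
   graphs are the case where (bend, wend) is injective. *)
Record bipartite_graph := BipartiteGraph {
  black : finType;
  white : finType;
  edge : finType;
  bend : edge -> black;
  wend : edge -> white }.

Definition vertex (G : bipartite_graph) : finType := (black G + white G)%type.

Definition incident (G : bipartite_graph) (v : vertex G) (e : edge G) : bool :=
  match v with
  | inl b => bend e == b
  | inr w => wend e == w
  end.

(* Edges are drawn as arcs parametrized by [0, 1] from the black to the white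
   end.  The case e = f of the last clause, with injectivity of pos, says that
   each arc is simple; distinct arcs may meet only at common end vertices. *)
Definition plane_drawing (R : realType) (G : bipartite_graph)
    (pos : vertex G -> R * R) (arc : edge G -> R -> R * R) : Prop :=
  [/\ injective pos,
      forall e, {within `[0, 1], continuous (arc e)},
      forall e, arc e 0 = pos (inl (bend e)) /\ arc e 1 = pos (inr (wend e)),
      forall e s v, 0 < s < 1 -> arc e s <> pos v
    & forall e f s t, 0 < s < 1 -> 0 <= t <= 1 ->
        arc e s = arc f t -> e = f /\ s = t].

Definition planar (R : realType) (G : bipartite_graph) : Prop :=
  exists (pos : vertex G -> R * R) (arc : edge G -> R -> R * R),
    plane_drawing pos arc.

Definition dimer_cover (G : bipartite_graph) (M : {set edge G}) : bool :=
  [forall v : vertex G, #|[set e in M | incident v e]| == 1%N].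

Definition cover_weight (R : realType) (G : bipartite_graph)
    (nu : edge G -> R) (M : {set edge G}) : R :=
  \prod_(e in M) nu e.

Definition partition_function (R : realType) (G : bipartite_graph)
    (nu : edge G -> R) : R :=
  \sum_(M : {set edge G} | dimer_cover M) cover_weight nu M.

Definition cover_prob (R : realType) (G : bipartite_graph)
    (nu : edge G -> R) (M : {set edge G}) : R :=
  if dimer_cover M then cover_weight nu M / partition_function nu else 0.

(* A coloring of the edges of M is encoded as a partial function on all edges,
   equal to None exactly off M. *)
Definition coloring_prob (R : realType) (k : nat) (G : bipartite_graph)
    (p : 'I_k -> edge G -> R) (M : {set edge G})
    (c : {ffun edge G -> option 'I_k}) : R :=
  \prod_(e : edge G)
     match c e with
     | Some i => if e \in M then p i e else 0
     | None => if e \in M then 0 else 1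
     end.

Definition records (k : nat) (G : bipartite_graph) (M : {set edge G})
    (c : {ffun edge G -> option 'I_k}) (x : {ffun white G -> 'I_k}) : bool :=
  [forall w : white G,
     [exists e in M, (wend e == w) && (c e == Some (x w))]].

Definition color_law (R : realType) (k : nat) (G : bipartite_graph)
    (nu : edge G -> R) (nuc : 'I_k -> edge G -> R)
    (x : {ffun white G -> 'I_k}) : R :=
  \sum_(M : {set edge G})
    \sum_(c : {ffun edge G -> option 'I_k} | records M c x)
      cover_prob nu M * coloring_prob (fun i e => nuc i e / nu e) M c.

(* A measure on the finite set [k]^W is given by its mass function mu; W is
   identified with {0, ..., #|W| - 1} by an arbitrary bijection o. *)
Definition k_determinantal (R : realType) (k : nat) (W : finType)
    (mu : {ffun W -> 'I_k} -> R) : Prop :=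
  [/\ forall x, 0 <= mu x,
      \sum_x mu x = 1
    & forall o : 'I_#|W| -> W, bijective o ->
        exists A : 'I_k -> 'M[R]_#|W|,
          \sum_i A i = 1%:M /\
          forall x : {ffun W -> 'I_k},
            mu x = \det (\matrix_(r, j) A (x (o j)) r j)].

(* Main.v *)
(* Kasteleyn's theorem is proved through angles instead of faces.  For disjoint
   arcs e = (b, w) and f = (b', w'), the difference e(s) - f(t) never vanishes on
   the square [0, 1]^2, so its argument has total variation zero along the
   boundary of the square.  Let turn(e, v) be the parity of the number of times
   e - v crosses the negative real axis.  Modulo 2 the vanishing says that
   turn(e, b') + turn(e, w') + turn(f, b) + turn(f, w) equals
   [b > b'] + [b > w'] + [w > b'] + [w > w'], where > is the order of vertices
   by height (and by abscissa at equal height).  Summed over the pairs of edges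
   of a dimer cover, [b > b'] + [w > w'] counts the inversions of the associated
   permutation, and every other term involves one edge and one vertex off that
   edge.  As a dimer cover covers every vertex once, the sign of the permutation
   is therefore, up to a global constant, a product of signs attached to the
   edges.  With these signs the weighted adjacency matrix K(g) satisfies
   det K(g) = C * sum over covers of prod g(e), and A_i = K(nu)^-1 K(nu_i). *)

Require Import Defs.
From HB Require Import structures.
From mathcomp Require Import all_boot all_order all_algebra perm.
From mathcomp Require Import all_classical all_reals all_analysis.
From mathcomp Require Import lra.
Set Implicit Arguments.
Unset Strict Implicit.
Unset Printing Implicit Defensive.
Import Order.TTheory GRing.Theory Num.Theory.
Import numFieldNormedType.Exports.
Local Open Scope classical_set_scope.
Local Open Scope ring_scope.

(** * Sampling disjoint arcs *)

(** These four half planes cover the nonzero vectors and reduce the study of crossings to cases on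
    signs. *)
Definition half_plane (R : realDomainType) (d : bool * bool) (x : R * R) : bool :=
  let c := if d.1 then x.1 else x.2 in if d.2 then 0 < c else c < 0.

(** A nonzero difference has a nonzero coordinate, whose sign persists by continuity. *)
Lemma half_plane_near (R : realType) (p q : R -> R * R) (A B : set R) (s t : R) :
  {within A, continuous p} -> {within B, continuous q}%classic ->
  A s -> B t -> p s <> q t ->
  exists d, exists2 e : R, 0 < e & forall s' t', A s' -> B t' ->
    `|s - s'| < e -> `|t - t'| < e -> half_plane d (p s' - q t').
Proof.
move=> /subspace_continuousP cp /subspace_continuousP cq As Bt pq.
have [d hd] : exists d, half_plane d (p s - q t).
  have : (p s - q t).1 != 0 \/ (p s - q t).2 != 0.
    apply/orP; rewrite -negb_and; apply/negP => /andP[/eqP h1 /eqP h2].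
    apply: pq; case: (p s) (q t) h1 h2 => [a b] [a' b'] /= h1 h2.
    by congr pair; apply/eqP; rewrite -subr_eq0 ?h1 ?h2.
  case; rewrite neq_lt => /orP[h|h].
  - by exists (true, false).
  - by exists (true, true).
  - by exists (false, false).
  - by exists (false, true).
pose c (x : R * R) := if d.1 then x.1 else x.2.
(* Half, because [p] and [q] may each move this coordinate by less than [r]. *)
pose r := `|c (p s - q t)| / 2.
have e0 : 0 < r.
  rewrite /r divr_gt0 // normr_gt0; move: hd; rewrite /half_plane -/(c _).
  by case: d.2; rewrite neq_lt => ->; rewrite ?orbT.
have [e1 /= e1_gt0 he1] := cp s As _ (nbhsx_ballx (p s) _ e0).
have [e2 /= e2_gt0 he2] := cq t Bt _ (nbhsx_ballx (q t) _ e0).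
exists d, (Num.min e1 e2) => [|s' t' As' Bt']; first by rewrite lt_min e1_gt0.
rewrite !lt_min => /andP[hs _] /andP[_ ht].
have [p1 p2] := he1 s' hs As'; have [q1 q2] := he2 t' ht Bt'.
have hp : `|c (p s) - c (p s')| < r.
  by rewrite /c; case: (d.1).
have hq : `|c (q t) - c (q t')| < r.
  by rewrite /c; case: (d.1).
have cB x y : c (x - y) = c x - c y by rewrite /c; case: (d.1).
move: hd hp hq; rewrite /r /half_plane -!/(c _) !cB.
case: d.2 => h; [rewrite (gtr0_norm h)|rewrite (ltr0_norm h)];
  rewrite !ltr_norml => /andP[? ?] /andP[? ?]; lra.
Qed.

(** A Lebesgue number argument: the square of parameters is compact, so every fine enough mesh
    serves all cells at once. *)
Lemma near_grid_half_plane (R : realType) (p q : R -> R * R) :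
  {within `[0, 1], continuous p} ->
  {within `[0, 1], continuous q} ->
  (forall s t : R, 0 <= s <= 1 -> 0 <= t <= 1 -> p s <> q t) ->
  \forall N \near \oo, forall i j, (i < N)%N -> (j < N)%N ->
    exists d, forall i' j', (i <= i' <= i.+1)%N -> (j <= j' <= j.+1)%N ->
      half_plane d (p (i'%:R / N%:R) - q (j'%:R / N%:R)).
Proof.
move=> cp cq pq.
pose P (N : nat) (z : R * R) := exists d, forall s t : R,
  0 <= s <= 1 -> 0 <= t <= 1 -> `|z.1 - s| <= N%:R^-1 -> `|z.2 - t| <= N%:R^-1 ->
  half_plane d (p s - q t).
have : \forall N \near \oo, (`[0, 1] `*` `[0, 1] `<=` P N).
  have /compact_near_coveringP := compact_setX (@segment_compact R 0 1)
    (@segment_compact R 0 1).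
  apply => -[s0 t0] [/=]; rewrite !in_itv /= => s01 t01.
  have [||d [e e_gt0 he]] := half_plane_near cp cq _ _ (pq _ _ s01 t01);
    rewrite /= ?in_itv //.
  have e2 : 0 < e / 2 by rewrite divr_gt0.
  (* Half of the radius [e] goes to the base point, half to the mesh. *)
  exists ([set z : R * R | ball (s0, t0) (e / 2) z], [set N : nat | (N%:R^-1 : R) < e / 2]).
    split => /=; first exact: (nbhsx_ballx _ _ e2).
    near=> N; rewrite /= invf_plt ?posrE //; last by near: N; exact: nbhs_infty_gtr.
    by near: N; exact: nbhs_infty_gtr.
  move=> [[s t] N] [/= [/= hs ht] hN]; exists d => s' t' s'01 t'01 /= hs' ht'.
  have hb (x y z : R) : ball x (e / 2) y -> `|y - z| <= N%:R^-1 -> `|x - z| < e.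
    move=> hxy hyz; rewrite (splitr e) -(subrKA y) (le_lt_trans (ler_normD _ _)) //.
    by rewrite ltrD // (le_lt_trans hyz).
  by apply: he; rewrite ?in_itv //=; [exact: hb hs hs'|exact: hb ht ht'].
move=> H; near=> N => i j iN jN.
have N0 : 0 < N%:R :> R by rewrite ltr0n (leq_ltn_trans _ iN).
have i01 i' : (i' <= N)%N -> 0 <= i'%:R / N%:R <= (1 : R).
  by move=> h; rewrite divr_ge0 //= ler_pdivrMr // mul1r ler_nat.
have close (m m' : nat) : (m <= m' <= m.+1)%N ->
    `|m%:R / N%:R - m'%:R / N%:R| <= N%:R^-1 :> R.
  case/andP => h1 h2; rewrite -mulrBl normrM [X in _ * X]gtr0_norm ?invr_gt0 // ler_piMl ?invr_ge0 ?(ltW N0) //.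
  rewrite distrC ger0_norm ?subr_ge0 ?ler_nat //.
  by rewrite lerBlDl natr1 ler_nat.
have [||d hd] := (near H N _ (i%:R / N%:R, j%:R / N%:R)) => //.
  by split => /=; rewrite in_itv /=; apply: i01; exact: ltnW.
exists d => i' j' hi hj; apply: hd; rewrite ?close ?i01 //.
  by case/andP: hi => _ /leq_trans; exact.
by case/andP: hj => _ /leq_trans; exact.
Unshelve. all: by end_near. Qed.

(** * Crossings of the negative real axis *)

Lemma telescope_addb (f : nat -> bool) n :
  \big[addb/false]_(i < n) (f i (+) f i.+1) = f 0 (+) f n.
Proof.
elim: n => [|n IH]; first by rewrite big_ord0 addbb.
by rewrite big_ord_recr /= IH addbA -(addbA (f 0)) addbb addbF.
Qed.

(** Stokes' formula modulo 2: summed over all cells, the interior grid edges cancel in pairs. *)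
Lemma grid_boundary_addb N (X Y : nat -> nat -> bool) :
  (forall i j, (i < N)%N -> (j < N)%N ->
     X i j (+) X i j.+1 = Y i j (+) Y i.+1 j) ->
  \big[addb/false]_(i < N) (X i 0 (+) X i N) =
  \big[addb/false]_(j < N) (Y 0 j (+) Y N j).
Proof.
move=> XY; under eq_bigr do rewrite -telescope_addb.
rewrite exchange_big; apply: eq_bigr => j _ /=.
by rewrite -(telescope_addb (Y^~ j)); apply: eq_bigr => i _; apply: XY.
Qed.

Section Crossings.
Variable R : realFieldType.
Implicit Types x y : R * R.

(** The nonzero vectors of argument in [0, pi), so that a nonzero [x] satisfies it exactly when
    [- x] does not. *)
Definition upper x : bool := (0 < x.2) || (x.2 == 0) && (0 < x.1).

(* For x and y in a common open half plane through the origin: whether the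
   segment from x to y crosses the negative real axis. *)
Definition cut x y : bool := (upper x (+) upper y) && (x.1 < 0).

Definition crossings (N : nat) (g : R -> R * R) : bool :=
  \big[addb/false]_(i < N) cut (g (i%:R / N%:R)) (g (i.+1%:R / N%:R)).

Lemma upperN x : x != 0 -> upper (- x) = ~~ upper x.
Proof.
case: x => a b; rewrite -[(a, b) == 0]/((a == 0) && (b == 0)) /upper /= !oppr_gt0 oppr_eq0.
by case: ltrgt0P => //= _; case: ltrgt0P.
Qed.

Lemma upperD x y : upper x -> upper y -> upper (x + y).
Proof.
rewrite /upper /= => /orP[h|/andP[/eqP-> h]] /orP[h'|/andP[/eqP-> h']].
- by rewrite addr_gt0.
- by rewrite addr0 h.
- by rewrite add0r h'.
- by rewrite add0r eqxx addr_gt0 ?orbT.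
Qed.

Lemma half_planeP d x : half_plane d x ->
  (if d.1 then (x.1 < 0) = ~~ d.2 /\ x.1 != 0 else upper x = d.2) /\ x != 0.
Proof.
case: d x => [[] []] [a b]; rewrite /half_plane /upper /= => h;
  rewrite -[(a, b) == 0]/((a == 0) && (b == 0)).
- by rewrite gt_eqF // ltNge ltW.
- by rewrite lt_eqF // h.
- by rewrite h gt_eqF // andbF.
- by rewrite lt_eqF // ltNge ltW // andbF.
Qed.

(** If [upper] is constant, nothing is cut. If the sign of the abscissa is constant, [cut] is zero
    or the variation of [upper], which sums to zero around the cell. *)
Lemma cut_cell d x y z t :
  half_plane d x -> half_plane d y -> half_plane d z -> half_plane d t ->
  cut x y (+) cut z t = cut x z (+) cut y t.
Proof.
move=> /half_planeP[hx _] /half_planeP[hy _] /half_planeP[hz _] /half_planeP[ht _].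
move: hx hy hz ht; rewrite /cut.
case: (d.1) => [[-> _] [-> _] [-> _] [_ _]|-> -> -> ->]; last by rewrite addbb.
by do 4![case: upper]; case: (d.2).
Qed.

(** Negation exchanges the two halves of the real axis, and crossing one of them amounts to a change
    of [upper]. *)
Lemma cutN d x y : half_plane d x -> half_plane d y ->
  cut (- x) (- y) = cut x y (+) (upper x (+) upper y).
Proof.
move=> /half_planeP[hx /upperN ux] /half_planeP[hy /upperN uy].
move: hx hy; rewrite /cut ux uy.
case: (d.1) => [[h1 h2] _|-> ->]; last by rewrite !addbb.
by rewrite oppr_lt0; case: ltrgt0P h2 => //; do 2![case: upper].
Qed.

(** The grid form of the vanishing variation of argument around the square. On the two sides where
    [p] is fixed, [cutN] reverses the difference, and its corrections telescope to the corners. *)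
Lemma crossings_boundary (N : nat) (p q : R -> R * R) : (0 < N)%N ->
  (forall i j, (i < N)%N -> (j < N)%N ->
    exists d, forall i' j', (i <= i' <= i.+1)%N -> (j <= j' <= j.+1)%N ->
      half_plane d (p (i'%:R / N%:R) - q (j'%:R / N%:R))) ->
  crossings N (fun s => p s - q 0) (+) crossings N (fun s => p s - q 1) (+)
  (crossings N (fun s => q s - p 0) (+) crossings N (fun s => q s - p 1)) =
  upper (p 0 - q 0) (+) upper (p 0 - q 1) (+)
  (upper (p 1 - q 0) (+) upper (p 1 - q 1)).
Proof.
move=> N_gt0 H; pose u i : R := i%:R / N%:R.
have u0 : u 0%N = 0 by rewrite /u mul0r.
have uN : u N = 1 by rewrite /u divff // pnatr_eq0 -lt0n.
pose F i j := p (u i) - q (u j).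
have XY i j : (i < N)%N -> (j < N)%N ->
    cut (F i j) (F i.+1 j) (+) cut (F i j.+1) (F i.+1 j.+1) =
    cut (F i j) (F i j.+1) (+) cut (F i.+1 j) (F i.+1 j.+1).
  by move=> iN jN; have [d hd] := H i j iN jN; apply: (@cut_cell d);
    apply: hd; rewrite ?leqnn ?leqnSn.
have side i j : (i <= N)%N -> (j < N)%N ->
    cut (F i j) (F i j.+1) = cut (q (u j) - p (u i)) (q (u j.+1) - p (u i)) (+)
      (upper (F i j) (+) upper (F i j.+1)).
  move=> iN jN; rewrite -opprB -[q (u j.+1) - _]opprB.
  have [d hd] : exists d, forall j', (j <= j' <= j.+1)%N -> half_plane d (F i j').
    (* No cell starts at [i = N], so a positive [i] uses the cell that ends there. *)
    case: i iN => [|i] iN; [have [d hd] := H 0%N j N_gt0 jN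
      |have [d hd] := H i j iN jN]; exists d => j' hj; apply: hd => //.
    by rewrite leqnn leqnSn.
  by rewrite (@cutN d) ?hd ?leqnn ?leqnSn // -addbA addbb addbF.
have := grid_boundary_addb XY; rewrite big_split /= => e.
rewrite /crossings -!/(u _).
transitivity (\big[addb/false]_(i < N) cut (F i 0%N) (F i.+1 0%N) (+)
   \big[addb/false]_(i < N) cut (F i N) (F i.+1 N) (+)
   (\big[addb/false]_(j < N) cut (q (u j) - p (u 0%N)) (q (u j.+1) - p (u 0%N)) (+)
   \big[addb/false]_(j < N) cut (q (u j) - p (u N)) (q (u j.+1) - p (u N)))).
  by rewrite /F u0 uN.
rewrite e -!big_split /=.
transitivity (\big[addb/false]_(j < N) ((upper (F 0%N j) (+) upper (F N j)) (+)
   (upper (F 0%N j.+1) (+) upper (F N j.+1)))); last first.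
  rewrite (telescope_addb (fun j => upper (F 0%N j) (+) upper (F N j))) /F u0 uN.
  by rewrite addbACA.
apply: eq_bigr => j _; rewrite !side //.
set a := cut _ _; set b := cut _ _.
by case: a b (upper _) (upper _) (upper _) (upper _) => [] [] [] [] [] [].
Qed.

End Crossings.

(** * Kasteleyn signs *)

(* Both sides are signs of Vandermonde determinants. *)
Lemma prod_sgr_perm (R : realDomainType) n (a : 'I_n -> R) (s : {perm 'I_n}) :
  \prod_(i < n) \prod_(j < n | (i < j)%N) Num.sg (a (s j) - a (s i)) =
  (-1) ^+ s * \prod_(i < n) \prod_(j < n | (i < j)%N) Num.sg (a j - a i).
Proof.
have sgV b : \prod_(i < n) \prod_(j < n | (i < j)%N) Num.sg (b j - b i) =
    Num.sg (\det (Vandermonde n (\row_i b i))) :> R.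
  rewrite det_Vandermonde (big_morph _ (@sgrM R) (@sgr1 R)); apply: eq_bigr => i _.
  rewrite (big_morph _ (@sgrM R) (@sgr1 R)); apply: eq_bigr => j _.
  by rewrite !mxE.
rewrite (sgV (a \o s)) sgV.
have -> : Vandermonde n (\row_i (a \o s) i) = col_perm s (Vandermonde n (\row_i a i)).
  by apply/matrixP => i j; rewrite !mxE.
by rewrite col_permE det_mulmx det_perm odd_permV sgrM mulrC sgrX sgrN1.
Qed.

Lemma prod_offdiag (R : comPzRingType) n (F : 'I_n -> 'I_n -> R) :
  \prod_i \prod_(j | j != i) F i j =
  \prod_(i < n) \prod_(j < n | (i < j)%N) (F i j * F j i).
Proof.
rewrite [RHS](eq_bigr _ (fun i _ => big_split _ _ _ _ _)) big_split /=.
rewrite [X in _ * X](exchange_big_dep xpredT) //= -big_split /=; apply: eq_bigr => i _.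
rewrite (bigID (fun j : 'I_n => (i < j)%N)) /=; congr (_ * _);
  by apply: eq_bigl => j; rewrite -val_eqE /=; case: ltngtP.
Qed.

(* The rank of v; comparing vertices by [upper (pos v - pos u)] is a strict
   linear order, as [upper] is the positive cone of a linear order on the plane. *)
Definition height (R : realType) (V : finType) (pos : V -> R * R) (v : V) : R :=
  #|[pred u | upper (pos v - pos u)]|%:R.

(** This puts the order of vertices into the form of signs of real differences, as in
    [prod_sgr_perm]. *)
Lemma sgr_height (R : realType) (V : finType) (pos : V -> R * R) (u v : V) :
  injective pos -> u != v ->
  Num.sg (height pos v - height pos u) = (-1) ^+ upper (pos u - pos v).
Proof.
move=> pos_inj; have lt x y : upper (pos x - pos y) -> height pos y < height pos x.
  move=> h; rewrite ltr_nat; apply/proper_card/properP; split.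
    apply/fintype.subsetP => z; rewrite !inE => /(upperD h).
    by rewrite addrA subrK.
  exists y; rewrite !inE // subrr /upper /=.
  by rewrite ltxx andbF.
move=> uv; case huv: (upper _); first by rewrite ltr0_sg ?subr_lt0 ?lt.
rewrite gtr0_sg ?subr_gt0 // lt // -opprB upperN ?huv //.
by rewrite subr_eq0 (inj_eq pos_inj).
Qed.

(** Interior points lie on no other arc and at no vertex, and coinciding end vertices would be both
    black or both white. *)
Lemma disjoint_arcs (R : realType) (G : bipartite_graph)
    (pos : vertex G -> R * R) (arc : edge G -> R -> R * R) (e f : edge G) :
  plane_drawing pos arc -> bend e != bend f -> wend e != wend f ->
  forall s t, 0 <= s <= 1 -> 0 <= t <= 1 -> arc e s <> arc f t.
Proof.
move=> [pos_inj _ ends inner cross] be we.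
have ef : e <> f by move=> ef; rewrite ef eqxx in be.
have end01 g (s : R) : 0 <= s <= 1 -> 0 < s < 1 \/
    exists2 v, arc g s = pos v & v = inl (bend g) \/ v = inr (wend g).
  have [h0 h1] := ends g; rewrite !le_eqVlt => /andP[/orP[/eqP <-|s0]].
    by move=> _; right; exists (inl (bend g)); [|left].
  case/orP => [/eqP->|s1]; last by left; rewrite s0.
  by right; exists (inr (wend g)); [|right].
move=> s t s01 t01 st.
have [hs|[v ev hv]] := end01 e s s01; first by have [] := cross e f s t hs t01 st.
have [ht|[v' ev' hv']] := end01 f t t01; first by apply: (inner f t v ht); rewrite -st.
have : v = v' by apply: pos_inj; rewrite -ev -ev'.
by case: hv hv' => -> [] -> // [] /eqP; rewrite ?(negbTE be) ?(negbTE we).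
Qed.

(* The number of sample points is the same for all pairs of edges, so that the
   crossing parities need not be shown independent of it. *)
Lemma planar_crossings (R : realType) (G : bipartite_graph)
    (pos : vertex G -> R * R) (arc : edge G -> R -> R * R) :
  plane_drawing pos arc ->
  exists turn : edge G -> vertex G -> bool,
    forall e f, bend e != bend f -> wend e != wend f ->
      turn e (inl (bend f)) (+) turn e (inr (wend f)) (+)
        (turn f (inl (bend e)) (+) turn f (inr (wend e))) =
      upper (pos (inl (bend e)) - pos (inl (bend f))) (+)
      upper (pos (inl (bend e)) - pos (inr (wend f))) (+)
      (upper (pos (inr (wend e)) - pos (inl (bend f))) (+)
       upper (pos (inr (wend e)) - pos (inr (wend f)))).
Proof.
move=> D; have [_ cont ends _ _] := D.
have H : \forall N \near \oo, forall ef : edge G * edge G,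
    bend ef.1 != bend ef.2 -> wend ef.1 != wend ef.2 ->
    forall i j, (i < N)%N -> (j < N)%N ->
    exists d, forall i' j', (i <= i' <= i.+1)%N -> (j <= j' <= j.+1)%N ->
      half_plane d (arc ef.1 (i'%:R / N%:R) - arc ef.2 (j'%:R / N%:R)).
  apply: filter_forall => -[e f] /=.
  have [be|be] := eqVneq (bend e) (bend f); first by apply: nearW.
  have [we|we] := eqVneq (wend e) (wend f); first by apply: nearW.
  near=> N => _ _; near: N.
  exact: near_grid_half_plane (cont e) (cont f) (disjoint_arcs D be we).
have [N [/= N_gt0 HN]] := @filter_ex _ \oo _ _ (filterI (nbhs_infty_gt 0) H).
exists (fun e v => crossings N (fun s => arc e s - pos v)) => e f be we.
have := crossings_boundary N_gt0 (HN (e, f) be we).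
by rewrite /= !(proj1 (ends _)) !(proj2 (ends _)).
Unshelve. all: by end_near. Qed.

Lemma kasteleyn_signing (R : realType) (G : bipartite_graph) n
    (o : 'I_n -> white G) (b : 'I_n -> black G) :
  planar R G -> bijective o -> bijective b ->
  exists (eps : edge G -> R) (C : R), C != 0 /\
    forall (phi : white G -> edge G) (s : {perm 'I_n}), cancel phi (@wend G) ->
      (forall j, bend (phi (o j)) = b (s j)) ->
      (-1) ^+ s * \prod_j eps (phi (o j)) = C.
Proof.
move=> [pos [arc D]] o_bij b_bij; have [pos_inj _ _ _ _] := D.
have [turn turnP] := planar_crossings D.
pose up u v := upper (pos u - pos v).
pose B v : vertex G := inl v; pose W v : vertex G := inr v.
(* Comparing the white end of an edge with a black vertex off it involves only that edge and that
   vertex, so it joins the sign of the edge. *)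
pose X e v : R := (-1) ^+ (turn e (B v) (+) up (W (wend e)) (B v)).
pose Y e v : R := (-1) ^+ turn e (W v).
exists (fun e => \prod_(v | v != bend e) X e v * \prod_(v | v != wend e) Y e v).
pose a v := height pos v.
exists ((\prod_(i < n) \prod_(j < n | (i < j)%N) Num.sg (a (B (b j)) - a (B (b i)))) *
  \prod_(i < n) \prod_(j < n | (i < j)%N) - Num.sg (a (W (o j)) - a (W (o i)))).
have sg_neq0 u v : u != v -> Num.sg (a v - a u) != 0.
  by move=> uv; rewrite sgr_height // signr_eq0.
have ltord (i j : 'I_n) : (i < j)%N -> i != j by rewrite -val_eqE /=; case: ltngtP.
split=> [|phi s phiK phib].
  rewrite mulf_neq0 //; apply/prodf_neq0 => i _; apply/prodf_neq0 => j /ltord ij.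
    by rewrite sg_neq0 // (inj_eq inl_inj) (inj_eq (bij_inj b_bij)).
  by rewrite oppr_eq0 sg_neq0 // (inj_eq inr_inj) (inj_eq (bij_inj o_bij)).
(* The vertices off an edge of the cover are the ends of its other edges, so the product runs over
   ordered pairs of edges. *)
have -> : \prod_j (\prod_(v | v != bend (phi (o j))) X (phi (o j)) v *
                   \prod_(v | v != wend (phi (o j))) Y (phi (o j)) v) =
    \prod_j \prod_(i | i != j) (X (phi (o j)) (b (s i)) * Y (phi (o j)) (o i)).
  apply: eq_bigr => j _; rewrite big_split /=; congr (_ * _).
    rewrite (reindex (b \o s)) /=; last first.
      by apply/onW_bij/bij_comp => //; exact: injF_bij perm_inj.
    by apply: eq_bigl => i; rewrite phib (inj_eq (bij_inj b_bij)) (inj_eq perm_inj).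
  rewrite (reindex o) /=; last exact/onW_bij.
  by apply: eq_bigl => i; rewrite phiK (inj_eq (bij_inj o_bij)).
rewrite prod_offdiag.
transitivity ((-1) ^+ s *
   ((\prod_(i < n) \prod_(j < n | (i < j)%N) Num.sg (a (B (b (s j))) - a (B (b (s i))))) *
  \prod_(i < n) \prod_(j < n | (i < j)%N) - Num.sg (a (W (o j)) - a (W (o i))))); last first.
  by rewrite (prod_sgr_perm (a \o B \o b)) /= mulrA mulrA -signr_addb addbb mul1r.
congr (_ * _); rewrite -big_split /=; apply: eq_bigr => i _.
rewrite -big_split /=; apply: eq_bigr => j /ltord ij.
rewrite !sgr_height //;
  try by rewrite ?(inj_eq inl_inj) ?(inj_eq inr_inj) ?(inj_eq (bij_inj b_bij))
    ?(inj_eq (bij_inj o_bij)) ?(inj_eq perm_inj).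
have bij : bend (phi (o i)) != bend (phi (o j)).
  by rewrite !phib (inj_eq (bij_inj b_bij)) (inj_eq perm_inj).
have wij : wend (phi (o i)) != wend (phi (o j)).
  by rewrite !phiK (inj_eq (bij_inj o_bij)).
have := turnP _ _ bij wij; rewrite !phiK !phib -!/(up _ _) -!/(B _) -!/(W _).
(* Reversed, this comparison is the one carried by the edge at [o j]; the negation accounts for the
   minus sign in the constant. *)
have -> : up (B (b (s i))) (W (o j)) = ~~ up (W (o j)) (B (b (s i))).
  by rewrite /up -upperN ?opprB // subr_eq0 (inj_eq pos_inj).
rewrite /X /Y !phiK -!signr_addb -signrN -signr_addb => e.
congr ((-1) ^+ nat_of_bool _); move: e.
by do 4!case: (turn _ _); do 4!case: (up _ _).
Qed.

(** * Dimer covers and determinants *)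

(** A matching given by its edge at each white vertex, the shape of a determinant term. With as many
    black as white vertices, injectivity makes it a dimer cover. *)
Definition selection (G : bipartite_graph) (phi : {ffun white G -> edge G}) : bool :=
  [forall w, wend (phi w) == w] && injectiveb (fun w => bend (phi w)).

Lemma selectionP (G : bipartite_graph) (phi : {ffun white G -> edge G}) :
  reflect (cancel phi (@wend G) /\ injective (fun w => bend (phi w)))
    (selection phi).
Proof.
apply: (iffP andP) => -[h1 h2]; split.
- by move=> w; apply/eqP/(forallP h1).
- exact/injectiveP.
- by apply/forallP => w; rewrite h1.
- exact/injectiveP.
Qed.

Lemma dimer_cover_selection (G : bipartite_graph) (M : {set edge G}) :
  dimer_cover M -> exists phi : {ffun white G -> edge G},
    [/\ M = [set phi w | w : white G]%SET, cancel phi (@wend G)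
      & bijective (fun w => bend (phi w))].
Proof.
move=> /forallP coverM.
have cover1 v : exists e, forall f, (f \in M) && incident v f = (f == e).
  have /cards1P[e he] := coverM v; exists e => f.
  by have /setP/(_ f) := he; rewrite !inE.
have [phi phiP] := fin_all_exists (fun w => cover1 (inr w)).
have [psi psiP] := fin_all_exists (fun b => cover1 (inl b)).
have phiM w : phi w \in M /\ wend (phi w) = w.
  by have := phiP w (phi w); rewrite eqxx => /andP[-> /eqP].
have psiM b : psi b \in M /\ bend (psi b) = b.
  by have := psiP b (psi b); rewrite eqxx => /andP[-> /eqP].
have phiE e : e \in M -> phi (wend e) = e.
  by move=> eM; apply/esym/eqP; rewrite -phiP eM /= eqxx.
have psiE e : e \in M -> psi (bend e) = e.
  by move=> eM; apply/esym/eqP; rewrite -psiP eM /= eqxx.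
exists (finfun phi); split.
- apply/setP => e; apply/idP/imsetP => [eM|[w _ ->]]; rewrite ?ffunE.
    by exists (wend e) => //; rewrite ffunE phiE.
  by case: (phiM w).
- by move=> w; rewrite ffunE; case: (phiM w).
- exists (fun b => wend (psi b)) => [w|b] /=; rewrite ffunE.
    by have [? ?] := phiM w; rewrite psiE.
  by have [? ?] := psiM b; rewrite phiE.
Qed.

Lemma selection_dimer_cover (G : bipartite_graph) (phi : {ffun white G -> edge G}) :
  #|black G| = #|white G| -> selection phi ->
  dimer_cover [set phi w | w : white G]%SET.
Proof.
move=> cardG /selectionP[phiK phi_inj].
have [psi psiK Kpsi] := inj_card_bij phi_inj (eq_leq cardG).
apply/forallP => -[b|w]; apply/cards1P.
- exists (phi (psi b)); apply/setP => e; rewrite !inE /=.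
  apply/andP/eqP => [[/imsetP[w _ ->] /eqP <-]|->]; first by rewrite psiK.
  by rewrite imset_f // Kpsi.
- exists (phi w); apply/setP => e; rewrite !inE /=.
  apply/andP/eqP => [[/imsetP[w' _ ->] /eqP <-]|->]; first by rewrite phiK.
  by rewrite imset_f // phiK.
Qed.

Lemma sum_dimer_cover (R : nmodType) (G : bipartite_graph) (F : {set edge G} -> R) :
  #|black G| = #|white G| ->
  \sum_(M : {set edge G} | dimer_cover M) F M =
  \sum_(phi : {ffun white G -> edge G} | selection phi)
    F [set phi w | w : white G]%SET.
Proof.
move=> cardG.
pose im (phi : {ffun white G -> edge G}) := [set phi w | w : white G]%SET.
rewrite -[RHS](big_imset _ (A := [pred phi | selection phi]) (h := im)) /=; last first.
  move=> phi psi /selectionP[phiK _] /selectionP[psiK _] e; apply/ffunP => w.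
  have /imsetP[w' _ ew'] : phi w \in im psi by rewrite -e imset_f.
  by rewrite ew' -(psiK w') -ew' phiK.
apply: eq_bigl => M; apply/idP/imsetP => [/dimer_cover_selection[phi [-> phiK phib]]|].
  by exists phi => //; apply/selectionP; split=> //; exact: bij_inj.
by move=> [phi sel ->]; apply: selection_dimer_cover.
Qed.

Lemma prod_selection (R : comPzSemiRingType) (G : bipartite_graph)
    (phi : {ffun white G -> edge G}) (g : edge G -> R) : cancel phi (@wend G) ->
  \prod_(e in [set phi w | w : white G]%SET) g e = \prod_w g (phi w).
Proof.
by move=> /can_inj phi_inj; rewrite big_imset // => w w' _ _; exact: phi_inj.
Qed.

Lemma partition_function_selection (R : realType) (G : bipartite_graph)
    (nu : edge G -> R) : #|black G| = #|white G| ->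
  partition_function nu =
  \sum_(phi : {ffun white G -> edge G} | selection phi) \prod_w nu (phi w).
Proof.
move=> cardG; rewrite /partition_function sum_dimer_cover //.
by apply: eq_bigr => phi /selectionP[phiK _]; exact: prod_selection.
Qed.

Lemma partition_function_gt0 (R : realType) (G : bipartite_graph)
    (nu : edge G -> R) :
  (exists M : {set edge G}, dimer_cover M) -> (forall e, 0 < nu e) ->
  0 < partition_function nu.
Proof.
move=> [M coverM] nu_gt0; rewrite /partition_function (bigD1 M) //=.
rewrite ltr_pwDl ?prodr_gt0 //; apply: sumr_ge0 => M' _.
by apply: prodr_ge0 => e _; exact: ltW.
Qed.

(** A single coloring contributes: being recorded fixes it on [M], and a color off [M] costs a zero
    factor. *)
Lemma sum_records_coloring_prob (R : realType) k (G : bipartite_graph)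
    (p : 'I_k -> edge G -> R) (x : {ffun white G -> 'I_k})
    (phi : {ffun white G -> edge G}) : cancel phi (@wend G) ->
  let M := [set phi w | w : white G]%SET in
  \sum_(c | records M c x) coloring_prob p M c = \prod_w p (x w) (phi w).
Proof.
move=> phiK M.
have memM e : e \in M -> e = phi (wend e) by move=> /imsetP[w _ ->]; rewrite phiK.
pose c0 := [ffun e => if e \in M then Some (x (wend e)) else None].
rewrite (bigD1 c0) /=; last first.
  apply/forallP => w; apply/existsP; exists (phi w).
  by rewrite imset_f // ffunE imset_f // phiK !eqxx.
rewrite [X in _ + X]big1 ?addr0 => [|c /andP[/forallP rec /eqP c_neq]].
  transitivity (\prod_w p (x (wend (phi w))) (phi w)).
    rewrite -(prod_selection (fun e => p (x (wend e)) e) phiK) [RHS]big_mkcond.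
    by apply: eq_bigr => e _; rewrite ffunE; case: (e \in M).
  by apply: eq_bigr => w _; rewrite phiK.
have [e ce] : exists e, c e != c0 e.
  apply/existsP; apply: contraT; rewrite negb_exists => /forallP h.
  by case: c_neq; apply/ffunP => e; apply/eqP; rewrite -[_ == _]negbK.
rewrite /coloring_prob (bigD1 e) //=; move: ce; rewrite ffunE.
case: ifP => [eM|_]; last by case: (c e) => //= i _; rewrite mul0r.
have /existsP[f /and3P[fM /eqP wf /eqP cf]] := rec (wend e).
have fe : f = e by rewrite (memM e eM) -wf -memM.
by rewrite -[in c e]fe cf eqxx.
Qed.

(** The weights [nu] in a cover weight cancel against the denominators of the color
    probabilities. *)
Lemma color_lawE (R : realType) (k : nat) (G : bipartite_graph)
    (nu : edge G -> R) (nuc : 'I_k -> edge G -> R) (x : {ffun white G -> 'I_k}) :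
  #|black G| = #|white G| -> (forall e, nu e != 0) ->
  color_law nu nuc x = (partition_function nu)^-1 *
    \sum_(phi : {ffun white G -> edge G} | selection phi) \prod_w nuc (x w) (phi w).
Proof.
move=> cardG nu0; rewrite /color_law (bigID (@dimer_cover G)) /= [X in _ + X]big1 ?addr0.
  rewrite sum_dimer_cover // big_distrr; apply: eq_bigr => phi sel.
  have [phiK _] := selectionP _ sel.
  rewrite -big_distrr /= sum_records_coloring_prob // /cover_prob.
  rewrite selection_dimer_cover // /cover_weight prod_selection // prodf_div.
  rewrite mulrAC mulrC; congr (_ * _); rewrite mulrC divfK //.
  by apply/prodf_neq0 => w _.
move=> M /negbTE ncover; rewrite big1 // => c _.
by rewrite /cover_prob ncover mul0r.
Qed.

(** Each entry sums over parallel edges; Kasteleyn signs are to be included in [g]. *)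
Definition kasteleyn_mx (R : realType) (G : bipartite_graph) n
    (o : 'I_n -> white G) (b : 'I_n -> black G) (g : edge G -> R) : 'M[R]_n :=
  \matrix_(r, j) \sum_(e | (bend e == b r) && (wend e == o j)) g e.

(** Distributing the entries gives a choice of edge per column, and [eps] absorbs the sign of the
    permutation. As [eps] and [C] precede [g], they serve [nu] and all colored weights alike. *)
Lemma det_kasteleyn_mx (R : realType) (G : bipartite_graph) n
    (o : 'I_n -> white G) (b : 'I_n -> black G) :
  planar R G -> bijective o -> bijective b ->
  exists (eps : edge G -> R) (C : R), C != 0 /\
    forall g : edge G -> R, \det (kasteleyn_mx o b (fun e => eps e * g e)) =
      C * \sum_(phi : {ffun white G -> edge G} | selection phi) \prod_w g (phi w).
Proof.
move=> planarG o_bij b_bij.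
have [eps [C [C0 epsP]]] := kasteleyn_signing planarG o_bij b_bij.
have [oi oK Ko] := o_bij; have [bi bK Kb] := b_bij.
(* Transposing makes each term a product over columns, that is, over white vertices. *)
exists eps, C; split=> // g; rewrite -det_tr /determinant.
pose Q (s : {perm 'I_n}) w e := (bend e == b (s (oi w))) && (wend e == w).
transitivity (\sum_(s : {perm 'I_n}) \sum_(phi in family (Q s))
    (-1) ^+ s * \prod_w (eps (phi w) * g (phi w))).
  apply: eq_bigr => s _; rewrite -big_distrr; congr (_ * _).
  rewrite -[RHS](bigA_distr_big_dep (Q s) (fun _ e => eps e * g e)).
  rewrite [RHS](reindex o) /=; last exact/onW_bij.
  by apply: eq_bigr => j _; rewrite !mxE; apply: eq_bigl => e; rewrite /Q oK.
have QP (s : {perm 'I_n}) (phi : {ffun white G -> edge G}) : phi \in family (Q s) ->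
    cancel phi (@wend G) /\ forall w, bend (phi w) = b (s (oi w)).
  by move=> /familyP h; split=> w; have /andP[/eqP ? /eqP] := h w.
rewrite (exchange_big_dep (@selection G)) /=; last first.
  move=> s phi _ /QP[phiK hb]; apply/selectionP; split=> // w w'; rewrite !hb.
  by move=> /(bij_inj b_bij)/perm_inj/(can_inj Ko).
rewrite big_distrr; apply: eq_bigr => phi /selectionP[phiK phi_inj].
(* The permutation of the only term in which [phi] occurs. *)
have s_inj : injective (fun j => bi (bend (phi (o j)))).
  by move=> i j /(can_inj Kb)/phi_inj/(bij_inj o_bij).
rewrite (big_pred1 (perm s_inj)) => [|s /=].
  rewrite big_split mulrA; congr (_ * _).
  rewrite (reindex o) /=; last exact/onW_bij.
  by apply: epsP => // j; rewrite permE Kb.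
apply/idP/eqP => [/QP[_ hb]|->].
  by apply/permP => j; rewrite permE hb oK bK.
by apply/familyP => w; rewrite /Q unfold_in permE Kb Ko phiK !eqxx.
Qed.

Theorem theorem4 (R : realType) (k : nat) (G : bipartite_graph)
    (nu : edge G -> R) (nuc : 'I_k -> edge G -> R)
    (hplanar : planar R G)
    (hcover : exists M : {set edge G}, dimer_cover M)
    (hnu : forall e, 0 < nu e)
    (hnuc : forall i e, 0 <= nuc i e)
    (hsum : forall e, nu e = \sum_(i < k) nuc i e) :
  k_determinantal (color_law nu nuc).
Proof.
have [M coverM] := hcover.
have [phi0 [_ phi0K phi0_bij]] := dimer_cover_selection coverM.
have cardG : #|black G| = #|white G| by rewrite (bij_eq_card phi0_bij).
have Z_gt0 := partition_function_gt0 hcover hnu.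
have lawE x := color_lawE nuc x cardG (fun e => lt0r_neq0 (hnu e)).
split=> [x||o o_bij].
- rewrite lawE mulr_ge0 ?invr_ge0 ?(ltW Z_gt0) //.
  by apply: sumr_ge0 => phi _; apply: prodr_ge0.
- under eq_bigr do rewrite lawE.
  rewrite -big_distrr exchange_big /=.
  (* Summing over all colorings factors over the white vertices, where the colored weights add up to
     [nu]. *)
  under eq_bigr => phi _.
    rewrite -(bigA_distr_bigA (fun w i => nuc i (phi w))).
    under eq_bigr do rewrite -hsum.
    over.
  by rewrite -partition_function_selection // mulVf // lt0r_neq0.
have b_bij : bijective (fun j => bend (phi0 (o j))) by exact: bij_comp phi0_bij o_bij.
have [eps [C [C0 detK]]] := det_kasteleyn_mx hplanar o_bij b_bij.
pose K g := kasteleyn_mx o (fun j => bend (phi0 (o j))) (fun e => eps e * g e).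
have detKnu : \det (K nu) = C * partition_function nu.
  by rewrite detK -partition_function_selection.
have Knu_unit : K nu \in unitmx.
  by rewrite unitmxE unitfE detKnu mulf_neq0 // lt0r_neq0.
exists (fun i => invmx (K nu) *m K (nuc i)); split=> [|x].
  rewrite -mulmx_sumr -[RHS](mulVmx Knu_unit); congr (_ *m _).
  apply/matrixP => r j; rewrite summxE mxE.
  under eq_bigr do rewrite mxE.
  rewrite exchange_big; apply: eq_bigr => e _.
  by rewrite -big_distrr hsum.
(* Column [j] only involves edges at [o j], so the mixed matrix comes from a single weight that
   reads the color at the white end. *)
have -> : \matrix_(r, j) (invmx (K nu) *m K (nuc (x (o j)))) r j =
    invmx (K nu) *m K (fun e => nuc (x (wend e)) e).
  apply/matrixP => r j; rewrite !mxE; apply: eq_bigr => l _; congr (_ * _).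
  by rewrite !mxE; apply: eq_bigr => e /andP[_ /eqP ->].
rewrite det_mulmx det_inv detKnu detK lawE invfM mulrACA mulVf // mul1r.
congr (_ * _); apply: eq_bigr => phi /selectionP[phiK _].
by apply: eq_bigr => w _; rewrite phiK.
Qed.
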